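(* Let $\Gamma\curvearrowright(X,\mu)$ be an mcp (measure-class preserving) Borel action of a countably infinite group $\Gamma$ on a standard atomless probability space $(X,\mu)$. If the action is totally ergodic, then it is chaining.
   Context: $\mathbb{N}$ includes $0$. The action is mcp if for all Borel $A\subseteq X$ and $\gamma\in\Gamma$, $\mu(A)=0$ iff $\mu(\gamma A)=0$. An action is ergodic if every invariant $\mu$-measurable set is null or conull; it is totally ergodic if every infinite subgroup of $\Gamma$ acts ergodically. For $k\in\mathbb{N}$, $A$ $k$-chains to $B$ if there are $\gamma_0=1_\Gamma,\gamma_1,\dots,\gamma_k\in\Gamma$ with $\mu(\gamma_iA\cap\gamma_{i+1}A)>0$ for each $0\le i<k$ and $\mu(\gamma_kA\cap B)>0$. The action is chaining if for all sets $A,B\subseteq X$ of positive measure there is $\ell\in\mathbb{N}$ such that $A$ $\ell$-chains to $B$. *)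

(* Defs.v *)
From HB Require Import structures.
From mathcomp Require Import all_boot all_order all_algebra.
From mathcomp Require Import all_classical all_reals all_analysis.
From mathcomp Require Import measurable_realfun.

Set Implicit Arguments.
Unset Strict Implicit.
Unset Printing Implicit Defensive.

Local Open Scope classical_set_scope.
Local Open Scope ereal_scope.

Definition polish_metric (R : realType) (T : metricType R) : Prop :=
  (forall F : set_system T, ProperFilter F -> cauchy F -> exists l : T, F --> l) /\
  exists2 S : set T, countable S & dense S.

(* Borel isomorphic to a Polish space equipped with its Borel sets *)
Definition standard_borel (R : realType) d (X : measurableType d) : Prop :=
  exists (T : metricType R) (f : X -> T),
    [/\ polish_metric T, bijective f &
        forall A : set X, measurable A <-> <<s @open T >> (f @` A)].

Section Measure.
Context d (X : measurableType d) (R : realType).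
Variable mu : set X -> \bar R.

Definition atomless : Prop :=
  forall A, measurable A -> 0 < mu A ->
  exists B, [/\ measurable B, B `<=` A, 0 < mu B & mu B < mu A].

(* The mu-measurable sets are those of the mu-completion of the Borel sets;
   on them the completed measure is the outer measure mu^*. *)
Definition mu_measurable (A : set X) : Prop := completed_algebra_gen mu A.

Definition null (A : set X) : Prop := mu.-negligible A.

Definition conull (A : set X) : Prop := mu.-negligible (~` A).

Definition pos_measure (A : set X) : Prop := 0 < (mu^*)%mu A.

End Measure.

Section Action.
Context (G : groupType) d (X : measurableType d) (R : realType).
Variables (act : G -> X -> X) (mu : set X -> \bar R).

(* G is meant to be countable and discrete, so joint measurability of the
   action is measurability of each act g. *)
Definition borel_action : Prop :=
  [/\ forall x, act 1%g x = x,
      forall g h x, act (g * h)%g x = act g (act h x) &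
      forall g, measurable_fun setT (act g)].

Definition mcp : Prop :=
  forall (A : set X) (g : G), measurable A ->
    (mu A = 0 <-> mu (act g @` A) = 0).

(* ergodicity of the restriction of the action to H *)
Definition ergodic (H : {pred G}) : Prop :=
  forall A : set X, mu_measurable mu A ->
    (forall g, g \in H -> act g @` A = A) -> null mu A \/ conull mu A.

Definition totally_ergodic : Prop :=
  forall H : {pred G}, group_closed H -> infinite_set [set g | g \in H] ->
    ergodic H.

Definition chains (k : nat) (A B : set X) : Prop :=
  exists g : nat -> G,
    [/\ g 0%N = 1%g,
        forall i, (i < k)%N ->
          pos_measure mu ((act (g i) @` A) `&` (act (g i.+1) @` A)) &
        pos_measure mu ((act (g k) @` A) `&` B)].

Definition chaining : Prop :=
  forall A B : set X, mu_measurable mu A -> mu_measurable mu B ->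
    pos_measure mu A -> pos_measure mu B -> exists l : nat, chains l A B.

End Action.

(* Main.v *)
(* Let S be the set of s such that A meets s A in positive measure. Since S is
   symmetric, the translates reached by chains from A are those by elements of
   the subgroup H generated by S. If H is infinite, H A is H-invariant, hence
   conull by total ergodicity, and so some h A meets B. If H is finite, atomlessness
   yields A' and D of positive measure in A with D disjoint from H A'; by ergodicity
   of the whole group some translate g A' meets D, so g lies in S, hence in H,
   a contradiction. *)

Require Import Defs.
From mathcomp Require Import all_boot all_order all_algebra.
From mathcomp Require Import all_classical all_reals all_analysis.

Set Implicit Arguments.
Unset Strict Implicit.
Unset Printing Implicit Defensive.

Import Order.TTheory.

Local Open Scope classical_set_scope.

Lemma negligible_countable_bigcup d (T : sigmaRingType d) (R : realFieldType)
    (mu : {measure set T -> \bar R}%R) (I : Type) (F : I -> set T) :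
  countable [set: I] -> (forall i, mu.-negligible (F i)) ->
  mu.-negligible (\bigcup_i F i).
Proof.
elim/Ppointed: I => I in F *.
  by move=> *; rewrite empty_eq0 bigcup0 //; exact: negligible_set0.
move=> /countable_bijP[B] /ppcard_eqP[f] nF.
rewrite (reindex_bigcup f^-1%FUN setT)//=; first exact: negligible_bigcup.
exact: (@subl_surj _ _ B).
Qed.

(* The submonoid generated by S, which is a subgroup when S is symmetric. *)
Inductive generated_by (G : groupType) (S : set G) : G -> Prop :=
| generated_by1 : generated_by S 1%g
| generated_byM g s : generated_by S g -> S s -> generated_by S (g * s)%g.

Lemma generated_by_sub (G : groupType) (S : set G) s : S s -> generated_by S s.
Proof.
by move=> Ss; rewrite -(mul1g s); apply: generated_byM => //; exact: generated_by1.
Qed.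

Lemma generated_by_mul (G : groupType) (S : set G) g h :
  generated_by S g -> generated_by S h -> generated_by S (g * h)%g.
Proof.
move=> Sg; elim=> [|k s _ IH Ss]; first by rewrite mulg1.
by rewrite mulgA; exact: generated_byM.
Qed.

Lemma generated_by_inv (G : groupType) (S : set G) g :
  (forall s, S s -> S s^-1%g) -> generated_by S g -> generated_by S g^-1%g.
Proof.
move=> SV; elim=> [|k s _ IH Ss]; first by rewrite invg1; exact: generated_by1.
by rewrite invgM; apply: generated_by_mul => //; exact/generated_by_sub/SV.
Qed.

(** Boolean form of [generated_by], obtained classically, since [totally_ergodic] ranges over
    [{pred G}]. *)
Definition generated_pred (G : groupType) (S : set G) : {pred G} :=
  [pred g | `[< generated_by S g >]].

Lemma generated_predP (G : groupType) (S : set G) g :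
  reflect (generated_by S g) (g \in generated_pred S).
Proof. exact: asboolP. Qed.

Lemma generated_pred_group_closed (G : groupType) (S : set G) :
  (forall s, S s -> S s^-1%g) -> group_closed (generated_pred S).
Proof.
move=> SV; split; first exact/generated_predP/generated_by1.
move=> g h /generated_predP Sg /generated_predP Sh; apply/generated_predP.
by apply: generated_by_mul => //; exact: generated_by_inv.
Qed.

Section MeasureClassPreservingAction.
Context (G : groupType) d (X : measurableType d) (R : realType).
Context (mu : {measure set X -> \bar R}%R) (act : G -> X -> X).
Context (act_borel : borel_action act) (act_mcp : mcp act mu).

Let act1 x : act 1%g x = x. Proof. by case: act_borel. Qed.

Let actM g h x : act (g * h)%g x = act g (act h x).
Proof. by case: act_borel => _ ->. Qed.

(** As preimages under the inverse, images commute with intersections and stay measurable. *)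
Lemma act_image g A : act g @` A = act g^-1%g @^-1` A.
Proof.
apply/seteqP; split => [_ [x Ax <-]|x Agx] /=; first by rewrite -actM mulVg act1.
by exists (act g^-1%g x); rewrite // -actM mulgV act1.
Qed.

Lemma act_image1 A : act 1%g @` A = A.
Proof. by rewrite act_image; apply/seteqP; split=> x /=; rewrite invg1 act1. Qed.

Lemma act_imageM g h A : act (g * h)%g @` A = act g @` (act h @` A).
Proof. by rewrite !act_image invgM; apply/seteqP; split=> x /=; rewrite actM. Qed.

Lemma act_imageI g A B : act g @` (A `&` B) = act g @` A `&` act g @` B.
Proof. by rewrite !act_image preimage_setI. Qed.

Lemma measurable_act_image g A : measurable A -> measurable (act g @` A).
Proof.
move=> mA; rewrite act_image -[X in measurable X]setTI.
by case: act_borel => _ _ /(_ g^-1%g); apply.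
Qed.

(** [mcp] speaks of measurable sets only, so it is applied to a measurable null set covering [A]. *)
Lemma negligible_act_image g A :
  mu.-negligible A -> mu.-negligible (act g @` A).
Proof.
move=> [N [mN N0 AN]]; exists (act g @` N); split.
- exact: measurable_act_image.
- by apply/(act_mcp g mN).
- exact: image_subset.
Qed.

Lemma negligible_act_imageE g A :
  mu.-negligible (act g @` A) -> mu.-negligible A.
Proof.
by move=> /(negligible_act_image g^-1%g); rewrite -act_imageM mulVg act_image1.
Qed.

Lemma pos_measureE A : measurable A -> pos_measure mu A <-> ~ mu.-negligible A.
Proof.
move=> mA; rewrite /pos_measure measurable_mu_extE // negligibleP //.
by rewrite lt0e measure_ge0 andbT; split => /eqP.
Qed.

(** [A] is a measurable set joined with a negligible one, and the former cannot be negligible too.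
    This reduces chaining to Borel sets. *)
Lemma mu_measurable_pos_sub A : mu_measurable mu A -> pos_measure mu A ->
  exists A', [/\ measurable A', A' `<=` A & ~ mu.-negligible A'].
Proof.
move=> [A' mA' [N negN AE]] posA; exists A'; split => //.
  by rewrite -AE; exact: subsetUl.
move=> negA'; move: (negligibleU negA' negN); rewrite AE => -[M [mM M0 AM]].
move: posA; rewrite /pos_measure ltNge => /negP; apply.
by rewrite -(etrans (measurable_mu_extE mu mM) M0); exact: le_mu_ext.
Qed.

Lemma atomless_split A : atomless mu -> measurable A -> ~ mu.-negligible A ->
  exists B, [/\ measurable B, B `<=` A, ~ mu.-negligible B &
                ~ mu.-negligible (A `\` B)].
Proof.
move=> almu mA /(pos_measureE mA); rewrite /pos_measure measurable_mu_extE // => A0.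
have [B [mB BA B0 BltA]] := almu A mA A0.
exists B; split => //.
  by apply/(pos_measureE mB); rewrite /pos_measure measurable_mu_extE.
move=> /(measure_negligible (measurableD mA mB)) AB0.
move: BltA; rewrite -(setDUK BA) measureU ?AB0 ?adde0 ?ltxx//.
  exact: measurableD.
by rewrite setDE setICA setICr setI0.
Qed.

(* Each further element h costs one splitting of A': of the disjoint images under h
   of the two parts, at least one misses a non-negligible part of D. *)
Lemma finite_translates_not_cover A (s : seq G) : atomless mu ->
  measurable A -> ~ mu.-negligible A ->
  exists A', [/\ measurable A', A' `<=` A, ~ mu.-negligible A' &
    exists D, [/\ measurable D, D `<=` A, ~ mu.-negligible D &
      forall h, h \in s -> D `&` act h @` A' = set0]].
Proof.
move=> almu mA nA; elim: s => [|h s [A' [mA' A'A nA' [D [mD DA nD DA']]]]].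
  by exists A; split => //; exists A; split.
have [B [mB BA' nB nA'B]] := atomless_split almu mA' nA'.
have keep C : measurable C -> C `<=` A' -> ~ mu.-negligible C ->
    ~ mu.-negligible (D `\` act h @` C) ->
    exists A0, [/\ measurable A0, A0 `<=` A, ~ mu.-negligible A0 &
    exists D0, [/\ measurable D0, D0 `<=` A, ~ mu.-negligible D0 &
      forall k, k \in h :: s -> D0 `&` act k @` A0 = set0]].
  move=> mC CA' nC nDC; exists C; split => //; first exact: subset_trans A'A.
  exists (D `\` act h @` C); split => //.
  - by apply: measurableD => //; exact: measurable_act_image.
  - by move=> x [/DA].
  - move=> k; rewrite inE => /predU1P[->|ks]; first by rewrite setDE -setIA setICl setI0.
    rewrite -subset0 -(DA' k ks) => x [[Dx _] Ckx]; split => //.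
    exact: image_subset Ckx.
have [negDB|nDB] := pselect (mu.-negligible (D `\` act h @` B)); last exact: keep nDB.
apply: (keep (A' `\` B)) => //; first exact: measurableD.
move=> negDA'B; apply: nD; apply: negligibleS (negligibleU negDB negDA'B) => x Dx.
rewrite !act_image; have [Bx|nBx] := pselect (B (act h^-1%g x)); last by left.
by right; split => // -[_].
Qed.

(** The union of the translates of [A] by [H] is [H]-invariant and contains [A], hence is conull.
    Were all its countably many pieces to meet [B] negligibly, [B] would be negligible. *)
Lemma ergodic_translate (H : {pred G}) A B : countable [set: G] ->
  group_closed H -> ergodic act mu H ->
  measurable A -> ~ mu.-negligible A -> ~ mu.-negligible B ->
  exists2 g, g \in H & ~ mu.-negligible (act g @` A `&` B).
Proof.
move=> cG [H1 HV] ergH mA nA nB; apply: contrapT => noH.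
have negAB g : g \in H -> mu.-negligible (act g @` A `&` B).
  by move=> gH; apply: contrapT => nAB; apply: noH; exists g.
have HM g h : g \in H -> h \in H -> (g * h)%g \in H.
  by move=> gH hH; rewrite -(invgK h) HV // -[h^-1%g]mul1g HV.
have HI g : g \in H -> g^-1%g \in H by move=> gH; rewrite -[g^-1%g]mul1g HV.
(* The empty value outside [H] lets the union run over all of [G], whose countability is what is
   assumed. *)
pose F g := if g \in H then act g @` A else set0.
pose U := \bigcup_g F g.
have Usub h : h \in H -> act h @` U `<=` U.
  move=> hH _ [x [g _ +] <-]; rewrite /F; case: ifP => // gH gAx.
  exists (h * g)%g => //; rewrite /F HM // act_imageM; exact: imageP.
have mU : mu_measurable mu U.
  exists U; last by exists set0; [exact: negligible_set0|rewrite setU0].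
  apply: countable_bigcupT_measurable => // g; rewrite /F; case: ifP => // _.
  exact: measurable_act_image.
have invU h : h \in H -> act h @` U = U.
  move=> hH; apply/seteqP; split; first exact: Usub.
  (* Write [U] as the image under [h] of its image under [h^-1], which lies in [U]. *)
  rewrite -[X in X `<=` _]act_image1 -(mulgV h) act_imageM.
  exact/image_subset/Usub/HI.
have [negU|negUC] := ergH U mU invU.
  apply: nA; apply: negligibleS negU => x Ax.
  by exists 1%g => //; rewrite /F H1 act_image1.
apply: nB.
have negUB : mu.-negligible (\bigcup_g (F g `&` B)).
  apply: negligible_countable_bigcup => // g; rewrite /F.
  case: ifP => [/negAB //|_].
  by rewrite set0I; exact: negligible_set0.
apply: negligibleS (negligibleU negUC negUB) => x Bx.
have [[g _ Fx]|nUx] := pselect (U x); last by left.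
by right; exists g.
Qed.

(* Consecutive translates g A, g s A meet non-negligibly exactly when A and s A do. *)
Lemma generated_by_chain A g : measurable A ->
  generated_by [set s | ~ mu.-negligible (A `&` act s @` A)] g ->
  exists k (f : nat -> G), [/\ f 0%N = 1%g, f k = g & forall i, (i < k)%N ->
    pos_measure mu (act (f i) @` A `&` act (f i.+1) @` A)].
Proof.
move=> mA; elim=> [|h s _ [k [f [f0 fk fS]]] Ss]; first by exists 0%N, (fun=> 1%g).
(* The chain is prolonged by [h * s] at index [k.+1]; only the link at [i = k] is new. *)
exists k.+1, (fun i => if (i <= k)%N then f i else (h * s)%g); split => //.
  by rewrite ltnn.
move=> i; rewrite ltnS /= => ik; rewrite ik.
move: ik; rewrite leq_eqVlt => /predU1P[->|ik]; last by rewrite ik; exact: fS.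
rewrite ltnn fk; apply/pos_measureE.
  by apply: measurableI; exact: measurable_act_image.
by rewrite act_imageM -act_imageI => /negligible_act_imageE.
Qed.

(** Translation by [s] carries the second intersection to the first. This symmetry makes the
    generated submonoid a subgroup. *)
Lemma return_set_inv A s : ~ mu.-negligible (A `&` act s @` A) ->
  ~ mu.-negligible (A `&` act s^-1%g @` A).
Proof.
apply: contra_not => /(negligible_act_image s).
by rewrite act_imageI -act_imageM mulgV act_image1 setIC.
Qed.

Lemma infinite_generated_by_return_set A : countable [set: G] ->
  infinite_set [set: G] -> atomless mu -> totally_ergodic act mu ->
  measurable A -> ~ mu.-negligible A ->
  infinite_set [set g | generated_by [set s | ~ mu.-negligible (A `&` act s @` A)] g].
Proof.
move=> cG infG almu terg mA nA /finite_seqP[s sE].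
have [A' [mA' A'A nA' [D [mD DA nD DA']]]] := finite_translates_not_cover s almu mA nA.
(* Here total ergodicity is applied to the whole group, which is infinite. *)
have gT : group_closed (predT : {pred G}) by [].
have [] := @ergodic_translate predT A' D cG gT _ mA' nA' nD.
  apply: (terg) => //; rewrite (_ : [set g | _] = setT) //.
  by apply/seteqP.
move=> g _ nA'D.
have gs : g \in s.
  suff : [set` s] g by [].
  (* Both [A'] and [D] lie in [A], so the intersection of [D] with the translate of [A'] by [g] lies
     in that of [A] with its own translate. *)
  rewrite -sE; apply: generated_by_sub => /=; apply: contra_not nA'D.
  by apply: negligibleS => x [gx Dx]; split; [exact: DA|exact: image_subset gx].
by apply: nA'D; rewrite setIC DA' //; exact: negligible_set0.
Qed.

End MeasureClassPreservingAction.

Theorem proposition4p8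
  (R : realType) (G : groupType) (d : measure_display) (X : measurableType d)
  (mu : probability X R) (act : G -> X -> X)
  (G_countable : countable [set: G]) (G_infinite : infinite_set [set: G])
  (X_standard : standard_borel R X) (mu_atomless : atomless mu)
  (act_borel : borel_action act) (act_mcp : mcp act mu)
  (act_totally_ergodic : totally_ergodic act mu) :
  chaining act mu.
Proof.
move=> A B mA mB posA posB.
have [A' [mA' A'A nA']] := mu_measurable_pos_sub mA posA.
have [B' [mB' B'B nB']] := mu_measurable_pos_sub mB posB.
pose S := [set s | ~ mu.-negligible (A' `&` act s @` A')].
have cH : group_closed (generated_pred S).
  by apply: generated_pred_group_closed => s; exact: return_set_inv.
have [] := ergodic_translate act_borel G_countable cH _ mA' nA' nB'.
  apply: (act_totally_ergodic) => //.
  rewrite (_ : [set g | _] = [set g | generated_by S g]).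
    exact: infinite_generated_by_return_set.
  by apply/seteqP; split => g /generated_predP.
move=> g /generated_predP Sg nAB.
have [k [f [f0 fk fS]]] := generated_by_chain act_borel act_mcp mA' Sg.
exists k, f; split => //.
(* The chain was built for [A'] and [B']; monotonicity of the outer measure transfers it to [A] and
   [B]. *)
- move=> i /fS /lt_le_trans; apply; apply: le_mu_ext.
  by apply: setISS; exact: image_subset.
- have mAB : measurable (act g @` A' `&` B').
    by apply: measurableI => //; exact: measurable_act_image.
  rewrite fk; move: nAB => /(pos_measureE _ mAB) /lt_le_trans; apply.
  by apply: le_mu_ext; apply: setISS => //; exact: image_subset.
Qed.
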